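(* Let $\alpha,\beta,\gamma\in\mathbb{R}$ and let $G_3$ be the connected, simply connected three-dimensional Lie group with left-invariant Lorentzian metric $g$ whose Lie algebra has a pseudo-orthonormal basis $\{\widetilde e_1,\widetilde e_2,\widetilde e_3\}$, with $\widetilde e_3$ timelike, satisfying $$[\widetilde e_1,\widetilde e_2]=-\gamma\widetilde e_3,\quad [\widetilde e_1,\widetilde e_3]=-\beta\widetilde e_2,\quad [\widetilde e_2,\widetilde e_3]=\alpha\widetilde e_1.$$ Then the symmetrized Ricci tensor $\widetilde\rho^B$ of the Bott connection $\nabla^B$ is a Codazzi tensor on $(G_3,\nabla^B)$.
   Context: Basis vectors are identified with left-invariant vector fields on the group $G$; $g(\widetilde e_1,\widetilde e_1)=g(\widetilde e_2,\widetilde e_2)=1$, $g(\widetilde e_3,\widetilde e_3)=-1$, and $g(\widetilde e_i,\widetilde e_j)=0$ for $i\ne j$. Let $\nabla^L$ be the Levi-Civita connection of $g$, $D=\mathrm{span}\{\widetilde e_1,\widetilde e_2\}$, $D^\perp=\mathrm{span}\{\widetilde e_3\}$ (distributions on $G$), with associated projections $\pi_D,\pi_{D^\perp}$ of $TG=D\oplus D^\perp$. The Bott connection $\nabla^B$ is the linear connection given by: $\nabla^B_XY=\pi_D(\nabla^L_XY)$ for $X,Y\in\Gamma^\infty(D)$; $\nabla^B_XY=\pi_D([X,Y])$ for $X\in\Gamma^\infty(D^\perp),Y\in\Gamma^\infty(D)$; $\nabla^B_XY=\pi_{D^\perp}([X,Y])$ for $X\in\Gamma^\infty(D),Y\in\Gamma^\infty(D^\perp)$;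 $\nabla^B_XY=\pi_{D^\perp}(\nabla^L_XY)$ for $X,Y\in\Gamma^\infty(D^\perp)$. Curvature: $R^B(X,Y)Z=\nabla^B_X\nabla^B_YZ-\nabla^B_Y\nabla^B_XZ-\nabla^B_{[X,Y]}Z$. Ricci tensor: $\rho^B(X,Y)=-g(R^B(X,\widetilde e_1)Y,\widetilde e_1)-g(R^B(X,\widetilde e_2)Y,\widetilde e_2)+g(R^B(X,\widetilde e_3)Y,\widetilde e_3)$. Symmetrized Ricci tensor: $\widetilde\rho^B(X,Y)=\tfrac12(\rho^B(X,Y)+\rho^B(Y,X))$. For a linear connection $\nabla$ and a $(0,2)$ tensor field $\omega$: $(\nabla_X\omega)(Y,Z)=X[\omega(Y,Z)]-\omega(\nabla_XY,Z)-\omega(Y,\nabla_XZ)$. The tensor $\omega$ is called a Codazzi tensor on $(G,\nabla)$ if $(\nabla_X\omega)(Y,Z)-(\nabla_Y\omega)(X,Z)=0$ for all vector fields $X,Y,Z$. *)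

(* Defs.v *)
From HB Require Import structures.
From mathcomp Require Import all_boot all_order all_algebra.
From mathcomp Require Import all_classical all_reals all_analysis.

Set Implicit Arguments.
Unset Strict Implicit.
Unset Printing Implicit Defensive.

Import Order.TTheory GRing.Theory Num.Theory.
Import numFieldNormedType.Exports.

Local Open Scope classical_set_scope.
Local Open Scope ring_scope.

Section Euclidean.
Context {R : realType} {n : nat}.
Implicit Types (U : set 'rV[R]_n) (f : 'rV[R]_n -> R).

Definition partial (i : 'I_n) f : 'rV[R]_n -> R :=
  fun x => 'D_(delta_mx 0 i) f x.

(* Only meaningful for U open: continuity and differentiability are those of
   the total function f at the points of U. *)
Fixpoint Ck (k : nat) U f : Prop :=
  if k is k'.+1 then
    (forall x, U x -> differentiable f x) /\ (forall i, Ck k' U (partial i f))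
  else forall x, U x -> {for x, continuous f}.

Definition smooth_on U f := forall k, Ck k U f.

End Euclidean.

Section Manifold.
Context {R : realType}.

Record chart (n : nat) (M : topologicalType) := Chart {
  chart_dom : set M;
  chart_cod : set 'rV[R]_n;
  chart_map : M -> 'rV[R]_n;
  chart_inv : 'rV[R]_n -> M;
  open_chart_dom : open chart_dom;
  open_chart_cod : open chart_cod;
  chart_map_cod : forall p, chart_dom p -> chart_cod (chart_map p);
  chart_inv_dom : forall x, chart_cod x -> chart_dom (chart_inv x);
  chart_mapK : forall p, chart_dom p -> chart_inv (chart_map p) = p;
  chart_invK : forall x, chart_cod x -> chart_map (chart_inv x) = x;
  chart_map_continuous :
    forall p, chart_dom p -> {for p, continuous chart_map};
  chart_inv_continuous :
    forall x, chart_cod x -> {for x, continuous chart_inv} }.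

(* The atlas need not be maximal. *)
Record smooth_structure (n : nat) (M : topologicalType) := SmoothStructure {
  atlas : set (chart n M);
  manifold_hausdorff : hausdorff_space M;
  manifold_second_countable : @second_countable M;
  atlas_cover : forall p, exists2 c, atlas c & chart_dom c p;
  atlas_compatible : forall c d, atlas c -> atlas d -> forall i : 'I_n,
    smooth_on (chart_cod c `&` chart_inv c @^-1` chart_dom d)
              (fun x => chart_map d (chart_inv c x) 0 i) }.

Definition smooth_fun n (M : topologicalType) (A : smooth_structure n M)
    (f : M -> R) :=
  forall c, atlas A c -> smooth_on (chart_cod c) (f \o chart_inv c).

(* U is open in R^m, and h is continuous on U in the uses below. *)
Definition smooth_into m n (N : topologicalType) (B : smooth_structure n N)
    (U : set 'rV[R]_m) (h : 'rV[R]_m -> N) :=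
  forall d, atlas B d -> forall i : 'I_n,
    smooth_on (U `&` h @^-1` chart_dom d) (fun x => chart_map d (h x) 0 i).

Definition smooth_map m n (M N : topologicalType) (A : smooth_structure m M)
    (B : smooth_structure n N) (F : M -> N) :=
  continuous F /\
  forall c, atlas A c -> smooth_into B (chart_cod c) (F \o chart_inv c).

(* Smoothness of a map M1 * M2 -> N, in the product charts, with R^(m1 + m2)
   identified with R^m1 * R^m2 through lsubmx and rsubmx. *)
Definition smooth_map2 m1 m2 n (M1 M2 N : topologicalType)
    (A1 : smooth_structure m1 M1) (A2 : smooth_structure m2 M2)
    (B : smooth_structure n N) (F : M1 -> M2 -> N) :=
  continuous (fun p : M1 * M2 => F p.1 p.2) /\
  forall c1 c2, atlas A1 c1 -> atlas A2 c2 ->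
    smooth_into B
      [set x : 'rV[R]_(m1 + m2) |
        chart_cod c1 (lsubmx x) /\ chart_cod c2 (rsubmx x)]
      (fun x => F (chart_inv c1 (lsubmx x)) (chart_inv c2 (rsubmx x))).

Definition path_connected (M : topologicalType) :=
  forall x y : M, exists l : R -> M,
    [/\ {within `[0, 1], continuous l}, l 0 = x & l 1 = y].

Definition simply_connected (M : topologicalType) :=
  path_connected M /\
  forall l : R -> M, {within `[0, 1], continuous l} -> l 0 = l 1 ->
  exists H : R * R -> M,
    [/\ {within `[0, 1] `*` `[0, 1], continuous H},
        forall t, `[0, 1]%classic t -> H (0, t) = l t,
        forall t, `[0, 1]%classic t -> H (1, t) = l 0 &
        forall s, `[0, 1]%classic s -> H (s, 0) = l 0 /\ H (s, 1) = l 0].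

End Manifold.

Arguments path_connected R M : clear implicits.
Arguments simply_connected R M : clear implicits.

Definition operator (R : realType) (M : Type) := (M -> R) -> (M -> R).

Section VectorFields.
Context {R : realType} {n : nat} {M : topologicalType}.
Variable A : smooth_structure (R := R) n M.
Implicit Types (X Y Z : operator R M) (f : M -> R).

(* A vector field is the operator f |-> X(f) on smooth functions which it
   induces, given in each chart by sum_i a_i d/dx_i with smooth a_i. The value
   on non-smooth functions is irrelevant and set to 0, so that equality of
   vector fields is equality of operators. *)
Definition vector_field X :=
  (forall f, ~ smooth_fun A f -> X f = 0) /\
  forall c, atlas A c -> exists a : 'I_n -> 'rV[R]_n -> R,
    (forall i, smooth_on (chart_cod c) (a i)) /\
    forall f, smooth_fun A f -> forall p, chart_dom c p ->
      X f p = \sum_(i < n) a i (chart_map c p) *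
                partial i (f \o chart_inv c) (chart_map c p).

Definition fscale f X : operator R M := fun h p => f p * X h p.

Definition lie_bracket X Y : operator R M := fun h => X (Y h) - Y (X h).

Record tensor02 (w : operator R M -> operator R M -> M -> R) : Prop := {
  tensor02_smooth : forall X Y, vector_field X -> vector_field Y ->
    smooth_fun A (w X Y);
  tensor02Dl : forall X X' Y,
    vector_field X -> vector_field X' -> vector_field Y ->
    w (X + X') Y = w X Y + w X' Y;
  tensor02Dr : forall X Y Y',
    vector_field X -> vector_field Y -> vector_field Y' ->
    w X (Y + Y') = w X Y + w X Y';
  tensor02Zl : forall f X Y,
    smooth_fun A f -> vector_field X -> vector_field Y ->
    w (fscale f X) Y = (fun p => f p * w X Y p);
  tensor02Zr : forall f X Y,
    smooth_fun A f -> vector_field X -> vector_field Y ->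
    w X (fscale f Y) = (fun p => f p * w X Y p) }.

(* Signature (n - 1, 1) at each point, hence nondegenerate. *)
Definition lorentzian_metric (g : operator R M -> operator R M -> M -> R) :=
  [/\ tensor02 g,
      forall X Y, vector_field X -> vector_field Y -> g X Y = g Y X &
      forall p, exists E : 'I_n -> operator R M,
        (forall i, vector_field (E i)) /\
        forall i j, g (E i) (E j) p =
          if i == j then (if i.+1 == n then -1 else 1) else 0].

Record connection (D : operator R M -> operator R M -> operator R M) : Prop := {
  connection_vector_field : forall X Y, vector_field X -> vector_field Y ->
    vector_field (D X Y);
  connectionDl : forall X X' Y,
    vector_field X -> vector_field X' -> vector_field Y ->
    D (X + X') Y = D X Y + D X' Y;
  connectionZl : forall f X Y,
    smooth_fun A f -> vector_field X -> vector_field Y ->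
    D (fscale f X) Y = fscale f (D X Y);
  connectionDr : forall X Y Y',
    vector_field X -> vector_field Y -> vector_field Y' ->
    D X (Y + Y') = D X Y + D X Y';
  connection_leibniz : forall f X Y,
    smooth_fun A f -> vector_field X -> vector_field Y ->
    D X (fscale f Y) = fscale (X f) Y + fscale f (D X Y) }.

Definition levi_civita (g : operator R M -> operator R M -> M -> R)
    (D : operator R M -> operator R M -> operator R M) :=
  [/\ connection D,
      forall X Y, vector_field X -> vector_field Y ->
        D X Y - D Y X = lie_bracket X Y &
      forall X Y Z, vector_field X -> vector_field Y -> vector_field Z ->
        X (g Y Z) = g (D X Y) Z + g Y (D X Z)].

(* Smooth sections of the distributions spanned by one or two vector fields. *)
Definition span1 X : set (operator R M) :=
  [set Z | exists2 f, smooth_fun A f & Z = fscale f X].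

Definition span2 X Y : set (operator R M) :=
  [set Z | exists f1 f2, [/\ smooth_fun A f1, smooth_fun A f2 &
                             Z = fscale f1 X + fscale f2 Y]].

(* The P-component of X, when every vector field decomposes uniquely as a sum
   of an element of P and an element of Q. *)
Definition proj (P Q : set (operator R M)) X : operator R M :=
  xget 0 [set Z | P Z /\ Q (X - Z)].

Definition bott_connection (P Q : set (operator R M))
    (DL DB : operator R M -> operator R M -> operator R M) :=
  [/\ connection DB,
      forall X Y, P X -> P Y -> DB X Y = proj P Q (DL X Y),
      forall X Y, Q X -> P Y -> DB X Y = proj P Q (lie_bracket X Y),
      forall X Y, P X -> Q Y -> DB X Y = proj Q P (lie_bracket X Y) &
      forall X Y, Q X -> Q Y -> DB X Y = proj Q P (DL X Y)].

Definition curvature (D : operator R M -> operator R M -> operator R M) X Y Z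
    : operator R M :=
  D X (D Y Z) - D Y (D X Z) - D (lie_bracket X Y) Z.

Definition ricci (g : operator R M -> operator R M -> M -> R)
    (e1 e2 e3 : operator R M)
    (D : operator R M -> operator R M -> operator R M) X Y : M -> R :=
  fun p => - g (curvature D X e1 Y) e1 p - g (curvature D X e2 Y) e2 p
           + g (curvature D X e3 Y) e3 p.

Definition sym_ricci (g : operator R M -> operator R M -> M -> R)
    (e1 e2 e3 : operator R M)
    (D : operator R M -> operator R M -> operator R M) X Y : M -> R :=
  fun p => 2^-1 * (ricci g e1 e2 e3 D X Y p + ricci g e1 e2 e3 D Y X p).

Definition cov_deriv (D : operator R M -> operator R M -> operator R M)
    (w : operator R M -> operator R M -> M -> R) X Y Z : M -> R :=
  fun p => X (w Y Z) p - w (D X Y) Z p - w Y (D X Z) p.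

Definition codazzi_tensor (D : operator R M -> operator R M -> operator R M)
    (w : operator R M -> operator R M -> M -> R) :=
  tensor02 w /\
  forall X Y Z, vector_field X -> vector_field Y -> vector_field Z ->
    forall p, cov_deriv D w X Y Z p - cov_deriv D w Y X Z p = 0.

End VectorFields.

(* A mere join: compatibility is part of lie_group. *)
#[short(type="topGroupType")]
HB.structure Definition TopGroup := {G of Topological G & Group G}.

Section LieGroup.
Context {R : realType} {n : nat} {G : topGroupType}.
Variable A : smooth_structure (R := R) n G.
Implicit Types (X Y : operator R G).

Definition lie_group :=
  smooth_map2 A A A (fun x y : G => (x * y)%g) /\
  smooth_map A A (fun x : G => x^-1%g).

(* Push-forward by the left translation x |-> a * x. *)
Definition left_push (a : G) X : operator R G :=
  fun f x => X (fun y => f (a * y)%g) (a^-1 * x)%g.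

Definition left_invariant X :=
  vector_field A X /\ forall a, left_push a X = X.

Definition left_invariant_metric
    (g : operator R G -> operator R G -> G -> R) :=
  forall a X Y, vector_field A X -> vector_field A Y ->
    forall x, g (left_push a X) (left_push a Y) x = g X Y (a^-1 * x)%g.

Definition lie_algebra_basis (e1 e2 e3 : operator R G) :=
  [/\ [/\ left_invariant e1, left_invariant e2 & left_invariant e3],
      forall c1 c2 c3 : R, c1 *: e1 + c2 *: e2 + c3 *: e3 = 0 ->
        [/\ c1 = 0, c2 = 0 & c3 = 0] &
      forall X, left_invariant X ->
        exists c1 c2 c3 : R, X = c1 *: e1 + c2 *: e2 + c3 *: e3].

Definition pseudo_orthonormal (g : operator R G -> operator R G -> G -> R)
    (e1 e2 e3 : operator R G) :=
  forall x, [/\ g e1 e1 x = 1, g e2 e2 x = 1 & g e3 e3 x = -1] /\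
            [/\ g e1 e2 x = 0, g e1 e3 x = 0 & g e2 e3 x = 0].

End LieGroup.

(* Main.v *)
Require Import Defs.
From mathcomp Require Import all_boot all_order all_algebra.
From mathcomp Require Import all_classical all_reals all_analysis.
From mathcomp Require Import perm ring.

Set Implicit Arguments.
Unset Strict Implicit.
Unset Printing Implicit Defensive.

Import GRing.Theory Num.Theory numFieldNormedType.Exports.
Local Open Scope classical_set_scope.
Local Open Scope ring_scope.

(** The symmetrized Ricci tensor of the Bott connection is not merely Codazzi
    but parallel, by a computation in the left-invariant frame.

    A left-invariant basis is a global frame: a combination of the e_i with
    constant coefficients which vanishes at one point vanishes everywhere, by
    translation ([left_invariant_pointwise_free]); so in each chart the matrix
    of coefficients of the e_i is invertible, and Cramer's formula shows that
    every vector field is X = x1 e1 + x2 e2 + x3 e3 with smooth x_i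
    ([pointwise_free_frame]).

    Within the plane spanned by e1, e2 the bracket [e1, e2] is orthogonal to
    the plane, so the metric and torsion conditions force the tangential part
    of the Levi-Civita connection to vanish on e1, e2
    ([levi_civita_plane]). The only non-zero values of the Bott connection on
    the frame are therefore D_e3 e1 = beta e2 and D_e3 e2 = - alpha e1
    ([bott_frame]), whence for X, Y, Z with coordinates x, y, z

      D_X Y = (X y1 - alpha x3 y2) e1 + (X y2 + beta x3 y1) e2 + (X y3) e3,
      R(X, Z) Y = gamma (x1 z2 - x2 z1) (- alpha y2 e1 + beta y1 e2),
      Ric(X, Y) = - beta gamma x1 y1 - alpha gamma x2 y2

    ([bott_frame_comb], [curvature_bott], [ricci_bott]). The Ricci form is
    already symmetric, and D acts on the plane, up to derivatives of the
    coordinates, by the generator (y1, y2) |-> x3 (- alpha y2, beta y1), which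
    is skew for the form beta y1 z1 + alpha y2 z2. So D Ric = 0
    ([sym_ricci_bott_parallel]). *)

(** * Smooth functions on open sets of R^n *)

(** The differential of [f] at [x] satisfies the characterization of that of
    [g], because the two error terms agree near 0. *)
Lemma near_eq_differentiable (R : numFieldType) (V W : normedModType R)
    (f g : V -> W) (x : V) :
  {near x, f =1 g} -> differentiable f x -> differentiable g x.
Proof.
move=> fg dfx; have cdf := diff_continuous dfx.
have dg : g \o shift x = cst (g x) + 'd f x +o_ 0 id.
  apply/eqaddoP => _/posnumP[eps].
  have /eqaddoP/(_ eps%:num (gt0 eps)) df := diff_locally dfx.
  have fg0 : \forall h \near 0, f (h + x) = g (h + x).
    by move: fg; rewrite (near_shift 0) subr0.
  near=> h.
  have -> : (g \o shift x - (cst (g x) + 'd f x)) h =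
            (f \o shift x - (cst (f x) + 'd f x)) h.
    rewrite /= !fctE /= (nbhs_singleton fg); congr (_ - _).
    by rewrite (near fg0 h).
  by near: h.
have dE : 'd g x = 'd f x :> (V -> W) by apply: diff_unique.
by apply/diff_locallyP; rewrite dE.
Unshelve. all: by end_near. Qed.

Section Smooth.
Context {R : realType} {n : nat}.
Implicit Types (U : set 'rV[R]_n) (f h : 'rV[R]_n -> R) (x : 'rV[R]_n).

Lemma near_open_eq U f h x : open U -> {in U, f =1 h} -> U x ->
  {near x, f =1 h}.
Proof.
move=> oU fh Ux; near=> y; apply: fh; rewrite inE; near: y.
exact: open_nbhs_nbhs.
Unshelve. all: by end_near. Qed.

Lemma partial_eq U f h i : open U -> {in U, f =1 h} ->
  {in U, partial i f =1 partial i h}.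
Proof.
move=> oU fh x; rewrite inE => Ux.
exact/near_eq_derive/(near_open_eq oU fh).
Qed.

Lemma partial_cst i (a : R) : partial i (cst a : 'rV[R]_n -> R) = cst 0.
Proof. by apply/funext => x; rewrite /partial derive_cst. Qed.

Lemma partialD i f h x : differentiable f x -> differentiable h x ->
  partial i (f + h) x = partial i f x + partial i h x.
Proof. by move=> df dh; rewrite /partial deriveD//; exact: diff_derivable. Qed.

Lemma partialM i f h x : differentiable f x -> differentiable h x ->
  partial i (f * h) x = partial i f x * h x + f x * partial i h x.
Proof.
move=> df dh; rewrite /partial deriveM; try exact: diff_derivable.
by rewrite addrC mulrC.
Qed.

Lemma partialV i f x : differentiable f x -> f x != 0 ->
  partial i (fun y => (f y)^-1) x = - (partial i f x * ((f x)^-1 * (f x)^-1)).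
Proof.
move=> df f0; rewrite /partial (deriveV f0 (diff_derivable df)).
by rewrite -invfM mulrC -mulNr.
Qed.

(** Smoothness refers to total functions, whereas the rules for partial
    derivatives of a product or an inverse only hold on the open set [U]; this
    lemma lets such identities on [U] be used under the recursion of [Ck]. *)
Lemma Ck_eq k U f h : open U -> {in U, f =1 h} -> Ck k U f -> Ck k U h.
Proof.
move=> oU; elim: k f h => [|k IHk] f h fh /=.
  move=> cf x Ux; have nfh := near_open_eq oU fh Ux.
  move: (cf x Ux); rewrite /prop_for /continuous_at (nbhs_singleton nfh).
  by apply: cvg_trans; exact: (near_eq_cvg nfh).
move=> [df pf]; split=> [x Ux|i].
  exact: near_eq_differentiable (near_open_eq oU fh Ux) (df x Ux).
exact: (IHk _ _ (partial_eq i oU fh) (pf i)).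
Qed.

Lemma CkW k U f : Ck k.+1 U f -> Ck k U f.
Proof.
elim: k f => [|k IHk] f [df pf].
  by move=> x Ux; exact/differentiable_continuous/df.
by split=> // i; exact/IHk/pf.
Qed.

Lemma Ck_cst k U (a : R) : Ck k U (cst a).
Proof.
elim: k a => [|k IHk] a /=; first by move=> x _; exact: cst_continuous.
by split=> [x _|i]; [exact: differentiable_cst | rewrite partial_cst].
Qed.

Lemma CkD k U f h : open U -> Ck k U f -> Ck k U h -> Ck k U (f + h).
Proof.
move=> oU; elim: k f h => [|k IHk] f h /=.
  by move=> cf ch x Ux; exact: (continuousD (cf x Ux) (ch x Ux)).
move=> [df pf] [dh ph]; split=> [x Ux|i].
  exact: (differentiableD (df x Ux) (dh x Ux)).
apply: Ck_eq (IHk _ _ (pf i) (ph i)) => // x; rewrite inE => Ux.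
by rewrite (partialD i (df x Ux) (dh x Ux)).
Qed.

Lemma CkM k U f h : open U -> Ck k U f -> Ck k U h -> Ck k U (f * h).
Proof.
move=> oU; elim: k f h => [|k IHk] f h.
  by move=> cf ch x Ux; exact: (continuousM (cf x Ux) (ch x Ux)).
move=> Cf Ch; have [[df pf] [dh ph]] := (Cf, Ch); split=> [x Ux|i].
  exact: (differentiableM (df x Ux) (dh x Ux)).
have := CkD oU (IHk _ _ (pf i) (CkW Ch)) (IHk _ _ (CkW Cf) (ph i)).
apply: Ck_eq => // x; rewrite inE => Ux.
by rewrite (partialM i (df x Ux) (dh x Ux)).
Qed.

(** By induction on the order: the partial derivatives of the inverse are
    polynomial in the inverse itself and the partial derivatives of [f]. *)
Lemma CkV k U f : open U -> (forall x, U x -> f x != 0) ->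
  Ck k U f -> Ck k U (fun x => (f x)^-1).
Proof.
move=> oU f0; elim: k => [|k IHk].
  by move=> cf x Ux; exact: (continuousV (f0 x Ux) (cf x Ux)).
move=> Cf; have [df pf] := Cf; have CV := IHk (CkW Cf); split=> [x Ux|i].
  exact: (differentiableV (df x Ux) (f0 x Ux)).
have := CkM oU (Ck_cst k U (-1)) (CkM oU (pf i) (CkM oU CV CV)).
apply: Ck_eq => // x; rewrite inE => Ux.
by rewrite (partialV i (df x Ux) (f0 x Ux)); exact: mulN1r.
Qed.

Lemma smooth_on_eq U f h : open U -> {in U, f =1 h} ->
  smooth_on U f -> smooth_on U h.
Proof. by move=> oU fh sf k; exact: Ck_eq (sf k). Qed.

Lemma smooth_on_cst U (a : R) : smooth_on U (cst a).
Proof. by move=> k; exact: Ck_cst. Qed.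

Lemma smooth_onD U f h : open U ->
  smooth_on U f -> smooth_on U h -> smooth_on U (f + h).
Proof. by move=> oU sf sh k; exact: CkD. Qed.

Lemma smooth_onM U f h : open U ->
  smooth_on U f -> smooth_on U h -> smooth_on U (f * h).
Proof. by move=> oU sf sh k; exact: CkM. Qed.

Lemma smooth_onV U f : open U -> (forall x, U x -> f x != 0) ->
  smooth_on U f -> smooth_on U (fun x => (f x)^-1).
Proof. by move=> oU f0 sf k; exact: CkV. Qed.

Lemma smooth_on_partial U f i : smooth_on U f -> smooth_on U (partial i f).
Proof. by move=> sf k; have [_] := sf k.+1; exact. Qed.

Lemma smooth_on_differentiable U f x : smooth_on U f -> U x ->
  differentiable f x.
Proof. by move=> sf; have [+ _] := sf 1; exact. Qed.

Lemma smooth_on_sum U (I : Type) (r : seq I) (P : pred I)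
    (F : I -> 'rV[R]_n -> R) : open U ->
  (forall i, smooth_on U (F i)) ->
  smooth_on U (fun x => \sum_(i <- r | P i) F i x).
Proof.
move=> oU sF; rewrite -fct_sumE.
elim/big_ind : _ => // [|f h]; [exact: smooth_on_cst | exact: smooth_onD].
Qed.

Lemma smooth_on_prod U (I : Type) (r : seq I) (P : pred I)
    (F : I -> 'rV[R]_n -> R) : open U ->
  (forall i, smooth_on U (F i)) ->
  smooth_on U (fun x => \prod_(i <- r | P i) F i x).
Proof.
move=> oU sF; rewrite -fct_prodE.
elim/big_ind : _ => // [|f h]; [exact: smooth_on_cst | exact: smooth_onM].
Qed.

Lemma smooth_on_det U m (a : 'I_m -> 'I_m -> 'rV[R]_n -> R) : open U ->
  (forall i j, smooth_on U (a i j)) ->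
  smooth_on U (fun x => \det (\matrix_(i, j) a i j x)).
Proof.
move=> oU sa; rewrite /determinant; apply: smooth_on_sum => // s.
apply: smooth_onM => //; first exact: smooth_on_cst.
rewrite (_ : (fun _ => _) = (fun x => \prod_i a i (s i) x)).
  exact: smooth_on_prod.
by apply/funext => x; apply: eq_bigr => i _; rewrite mxE.
Qed.

(** Cramer's formula: the entries of the inverse matrix are cofactors divided
    by the determinant. *)
Lemma smooth_on_invmx U m (a : 'I_m -> 'I_m -> 'rV[R]_n -> R) i j : open U ->
  (forall k l, smooth_on U (a k l)) ->
  (forall x, U x -> (\matrix_(k, l) a k l x) \in unitmx) ->
  smooth_on U (fun x => invmx (\matrix_(k, l) a k l x) i j).
Proof.
move=> oU sa ua.
pose cof x := cofactor (\matrix_(k, l) a k l x) j i.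
have scof : smooth_on U cof.
  rewrite /cof /cofactor; apply: smooth_onM => //; first exact: smooth_on_cst.
  rewrite (_ : (fun _ => _) = (fun x => \det (\matrix_(k, l)
    a (lift j k) (lift i l) x))); first exact: smooth_on_det.
  by apply/funext => x; congr (\det _); apply/matrixP => k l; rewrite !mxE.
have sV : smooth_on U (fun x => (\det (\matrix_(k, l) a k l x))^-1).
  apply: smooth_onV => //; last exact: smooth_on_det.
  by move=> x /ua; rewrite unitmxE unitfE.
apply: (smooth_on_eq oU) (smooth_onM oU sV scof) => x; rewrite inE => Ux.
by rewrite /invmx ua// !mxE.
Qed.

End Smooth.

(** * Vector fields and pointwise independent frames *)

Section VectorFields.
Context {R : realType} {n : nat} {M : topologicalType}.
Variable A : smooth_structure (R := R) n M.
Implicit Types (X Y : operator R M) (f h : M -> R) (p : M).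

Lemma smooth_fun_cst (a : R) : smooth_fun A (cst a).
Proof. by move=> c _; exact: smooth_on_cst. Qed.

Lemma smooth_funD f h :
  smooth_fun A f -> smooth_fun A h -> smooth_fun A (f + h).
Proof.
move=> sf sh c Ac; apply: (smooth_onD _ (sf c Ac) (sh c Ac)).
exact: open_chart_cod.
Qed.

Lemma smooth_funM f h :
  smooth_fun A f -> smooth_fun A h -> smooth_fun A (f * h).
Proof.
move=> sf sh c Ac; apply: (smooth_onM _ (sf c Ac) (sh c Ac)).
exact: open_chart_cod.
Qed.

Lemma smooth_funB f h :
  smooth_fun A f -> smooth_fun A h -> smooth_fun A (f - h).
Proof.
move=> sf sh; rewrite (_ : f - h = f + cst (-1) * h).
  by apply: smooth_funD => //; apply: smooth_funM => //; exact: smooth_fun_cst.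
by congr (_ + _); apply/funext => p; rewrite !fctE mulN1r.
Qed.

Lemma smooth_fun_differentiable f c p : smooth_fun A f -> atlas A c ->
  chart_dom c p -> differentiable (f \o chart_inv c) (chart_map c p).
Proof.
move=> sf Ac cp.
exact: (smooth_on_differentiable (sf c Ac) (chart_map_cod cp)).
Qed.

Lemma vector_field_smooth X f :
  vector_field A X -> smooth_fun A f -> smooth_fun A (X f).
Proof.
move=> [_ locX] sf c Ac; have [a [sa Xa]] := locX c Ac.
have oc := @open_chart_cod _ _ _ c.
have sXf : smooth_on (chart_cod c)
    (fun x => \sum_(i < n) a i x * partial i (f \o chart_inv c) x).
  apply: smooth_on_sum => // i; apply: smooth_onM => //.
  exact/smooth_on_partial/sf.
apply: (smooth_on_eq oc) sXf => x; rewrite inE => cx.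
by rewrite /= Xa//; [rewrite chart_invK | exact: chart_inv_dom].
Qed.

Lemma vector_field_cst X (a : R) : vector_field A X -> X (cst a) = 0.
Proof.
move=> [_ locX]; apply/funext => p; have [c Ac cp] := atlas_cover A p.
have [b [_ ->//]] := locX c Ac; last exact: smooth_fun_cst.
rewrite big1// => i _; rewrite (_ : _ \o _ = cst a)//.
by rewrite partial_cst mulr0.
Qed.

Lemma vector_fieldD X f h : vector_field A X ->
  smooth_fun A f -> smooth_fun A h -> X (f + h) = X f + X h.
Proof.
move=> [_ locX] sf sh; apply/funext => p; have [c Ac cp] := atlas_cover A p.
have [b [_ Xb]] := locX c Ac.
rewrite -[RHS]/(X f p + X h p) !Xb//; last exact: smooth_funD.
rewrite -big_split; apply: eq_bigr => i _ /=; rewrite -mulrDr; congr (_ * _).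
by apply: (partialD i); exact: smooth_fun_differentiable.
Qed.

Lemma vector_fieldM X f h : vector_field A X ->
  smooth_fun A f -> smooth_fun A h -> X (f * h) = X f * h + f * X h.
Proof.
move=> [_ locX] sf sh; apply/funext => p; have [c Ac cp] := atlas_cover A p.
have [b [_ Xb]] := locX c Ac.
rewrite -[RHS]/(X f p * h p + f p * X h p) !Xb//; last exact: smooth_funM.
rewrite big_distrl big_distrr -big_split; apply: eq_bigr => i _ /=.
have := @partialM _ _ i (f \o chart_inv c) (h \o chart_inv c) (chart_map c p).
move=> -> //; try exact: smooth_fun_differentiable.
by rewrite /= chart_mapK// mulrDr mulrA mulrCA.
Qed.

Lemma vector_fieldB X f h : vector_field A X ->
  smooth_fun A f -> smooth_fun A h -> X (f - h) = X f - X h.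
Proof.
move=> vX sf sh; apply/eqP; rewrite eq_sym subr_eq -vector_fieldD//.
  by rewrite subrK.
exact: smooth_funB.
Qed.

Lemma vector_field0 X f : vector_field A X -> ~ smooth_fun A f -> X f = 0.
Proof. by move=> [+ _]; exact. Qed.

Lemma vector_field_fscale f X :
  smooth_fun A f -> vector_field A X -> vector_field A (fscale f X).
Proof.
move=> sf [X0 locX]; split=> [h nh|c Ac].
  by apply/funext => p; rewrite /fscale X0//= mulr0.
have [a [sa Xa]] := locX c Ac; exists (fun i => (f \o chart_inv c) * a i).
split=> [i|h sh p cp].
  by apply: smooth_onM (@open_chart_cod _ _ _ c) (sf c Ac) (sa i).
rewrite /fscale (Xa h sh p cp) big_distrr; apply: eq_bigr => i _.
by rewrite !fctE /= chart_mapK// mulrA.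
Qed.

Lemma vector_field_add X Y :
  vector_field A X -> vector_field A Y -> vector_field A (X + Y).
Proof.
move=> [X0 locX] [Y0 locY]; split=> [h nh|c Ac].
  by rewrite fctE X0// Y0// addr0.
have [a [sa Xa]] := locX c Ac; have [b [sb Yb]] := locY c Ac.
exists (fun i => a i + b i); split=> [i|h sh p cp].
  by apply: smooth_onD (@open_chart_cod _ _ _ c) (sa i) (sb i).
rewrite -[LHS]/(X h p + Y h p) (Xa h sh p cp) (Yb h sh p cp) -big_split.
by apply: eq_bigr => i _ /=; rewrite -mulrDl.
Qed.

(** Evaluation at [p] on all smooth functions stands for the tangent vector at
    [p], so this is linear independence in every tangent space. *)
Definition pointwise_free (E : 'I_n -> operator R M) :=
  forall p (v : 'I_n -> R),
    (forall f, smooth_fun A f -> \sum_i v i * E i f p = 0) ->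
    forall i, v i = 0.

(** In a chart, a row vector killing the matrix of coefficients of the [E i]
    would be a relation between the [E i] at a point, so this matrix is
    invertible, and the coordinates of [X] are obtained from its coefficients
    through the inverse matrix. *)
Lemma pointwise_free_local_frame (E : 'I_n -> operator R M) X c :
  (forall i, vector_field A (E i)) -> pointwise_free E ->
  vector_field A X -> atlas A c ->
  exists w : 'I_n -> 'rV[R]_n -> R,
    (forall i, smooth_on (chart_cod c) (w i)) /\
    forall f, smooth_fun A f -> forall p, chart_dom c p ->
      X f p = \sum_i w i (chart_map c p) * E i f p.
Proof.
move=> vE freeE [_ locX] Ac; have oc := @open_chart_cod _ _ _ c.
have [b [sb Xb]] := locX c Ac.
have /choice[a aP] : forall i, exists a : 'I_n -> 'rV[R]_n -> R,
    (forall j, smooth_on (chart_cod c) (a j)) /\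
    forall f, smooth_fun A f -> forall p, chart_dom c p ->
      E i f p = \sum_j a j (chart_map c p) *
                  partial j (f \o chart_inv c) (chart_map c p).
  by move=> i; have [_ locE] := vE i; exact: locE.
pose J x := \matrix_(i, j) a i j x.
pose d f x : 'cV[R]_n := \col_j partial j (f \o chart_inv c) x.
have EJ f p (v : 'rV[R]_n) : smooth_fun A f -> chart_dom c p ->
    \sum_i v 0 i * E i f p =
    (v *m J (chart_map c p) *m d f (chart_map c p)) 0 0.
  move=> sf cp; rewrite -mulmxA mxE; apply: eq_bigr => i _; congr (_ * _).
  rewrite (aP i).2// mxE; apply: eq_bigr => j _.
  by rewrite !mxE.
have uJ x : chart_cod c x -> J x \in unitmx.
  move=> cx; rewrite unitmxE unitfE; apply/negP => /det0P[v v0 vJ].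
  move/eqP: v0; apply; apply/rowP => i; rewrite mxE.
  apply: (freeE (chart_inv c x) (v 0)) => f sf.
  have dx := chart_inv_dom cx.
  by rewrite EJ// chart_invK// vJ mul0mx mxE.
exists (fun i x => \sum_j b j x * invmx (J x) j i).
split=> [i|f sf p cp].
  apply: smooth_on_sum => // j; apply: smooth_onM => //.
  by apply: smooth_on_invmx => // k l; exact: (aP k).1.
pose y := \row_j b j (chart_map c p) *m invmx (J (chart_map c p)).
transitivity (\sum_i y 0 i * E i f p).
  rewrite EJ// mulmxKV; last exact/uJ/chart_map_cod.
  by rewrite mxE Xb//; apply: eq_bigr => j _; rewrite !mxE.
apply: eq_bigr => i _; congr (_ * _).
by rewrite mxE; apply: eq_bigr => j _; rewrite mxE.
Qed.

(** The coordinates of [X] at each point are unique, hence the local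
    expressions given by the charts are pieces of globally defined smooth
    functions. *)
Lemma pointwise_free_frame (E : 'I_n -> operator R M) X :
  (forall i, vector_field A (E i)) -> pointwise_free E -> vector_field A X ->
  exists u : 'I_n -> M -> R,
    (forall i, smooth_fun A (u i)) /\ X = \sum_i fscale (u i) (E i).
Proof.
move=> vE freeE vX.
have /choice[u uP] : forall p, exists v : 'I_n -> R,
    forall f, smooth_fun A f -> X f p = \sum_i v i * E i f p.
  move=> p; have [c Ac cp] := atlas_cover A p.
  have [w [_ Xw]] := pointwise_free_local_frame vE freeE vX Ac.
  by exists (w ^~ (chart_map c p)) => f sf; exact: Xw.
exists (fun i p => u p i); split=> [i c Ac|].
  have [w [sw Xw]] := pointwise_free_local_frame vE freeE vX Ac.
  apply: (smooth_on_eq (@open_chart_cod _ _ _ c)) (sw i) => x.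
  rewrite inE => cx.
  have dx := chart_inv_dom cx.
  apply/subr0_eq; pose v j := w j x - u (chart_inv c x) j.
  apply: (freeE (chart_inv c x) v) => f sf.
  under eq_bigr do rewrite mulrBl.
  by rewrite sumrB -uP// -{1}(chart_invK cx) -Xw// subrr.
apply/funext => f; apply/funext => p; rewrite !fct_sumE.
have [sf|nf] := pselect (smooth_fun A f); first exact: uP.
rewrite (vector_field0 vX nf) big1// => i _.
by rewrite /fscale (vector_field0 (vE i) nf) mulr0.
Qed.

End VectorFields.

(** * Left-invariant frames and coordinates with respect to a frame *)

(** The value at [x] of a left-invariant field is the translate of its value
    at [p], so a relation at [p] propagates to the whole group. *)
Lemma left_invariant_pointwise_free (R : realType) (n : nat) (G : topGroupType)
    (A : smooth_structure (R := R) n G) (E : 'I_n -> operator R G) :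
  (forall i, left_invariant A (E i)) ->
  (forall c : 'I_n -> R, \sum_i c i *: E i = 0 -> forall i, c i = 0) ->
  pointwise_free A E.
Proof.
move=> invE freeE p v Ev0; apply: freeE.
apply/funext => f; apply/funext => x; rewrite !fct_sumE /=.
pose f' y := f (x * p^-1 * y)%g.
have Ef i : E i f x = E i f' p.
  have [_ /(_ (x * p^-1)%g) {1}<-] := invE i.
  by rewrite /left_push invgF mulgVK.
have [sf'|nf'] := pselect (smooth_fun A f').
  by rewrite -[RHS](Ev0 f' sf'); apply: eq_bigr => i _; rewrite -Ef.
rewrite big1// => i _.
rewrite -[LHS]/(v i * E i f x) Ef (vector_field0 (invE i).1 nf').
exact: mulr0.
Qed.

Section Frame.
Context {R : realType} {n : nat} {G : topGroupType}.
Variable A : smooth_structure (R := R) n G.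
Variables e1 e2 e3 : operator R G.
Implicit Types (X Y Z : operator R G) (f h x y z : G -> R).
Local Notation smooth := (smooth_fun A).

Definition frame_comb x1 x2 x3 : operator R G :=
  fscale x1 e1 + fscale x2 e2 + fscale x3 e3.

Hypothesis ve1 : vector_field A e1.
Hypothesis ve2 : vector_field A e2.
Hypothesis ve3 : vector_field A e3.

Lemma frame_comb_vector_field x1 x2 x3 : smooth x1 -> smooth x2 -> smooth x3 ->
  vector_field A (frame_comb x1 x2 x3).
Proof.
by move=> *; do 2?apply: vector_field_add; exact: vector_field_fscale.
Qed.

Lemma frame_combE x1 x2 x3 h :
  frame_comb x1 x2 x3 h = x1 * e1 h + x2 * e2 h + x3 * e3 h.
Proof. by []. Qed.

Lemma smooth_fun0 : smooth 0.
Proof. exact: smooth_fun_cst. Qed.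

Lemma smooth_fun1 : smooth 1.
Proof. exact: smooth_fun_cst. Qed.

Lemma frame_comb1 : e1 = frame_comb 1 0 0.
Proof. by apply/funext => h; rewrite frame_combE mul1r !mul0r !addr0. Qed.

Lemma frame_comb2 : e2 = frame_comb 0 1 0.
Proof. by apply/funext => h; rewrite frame_combE mul1r !mul0r addr0 add0r. Qed.

Lemma frame_comb3 : e3 = frame_comb 0 0 1.
Proof. by apply/funext => h; rewrite frame_combE mul1r !mul0r !add0r. Qed.

Lemma frame_combB x1 x2 x3 y1 y2 y3 :
  frame_comb x1 x2 x3 - frame_comb y1 y2 y3 =
  frame_comb (x1 - y1) (x2 - y2) (x3 - y3).
Proof.
apply/funext => h.
rewrite -[LHS]/(frame_comb x1 x2 x3 h - frame_comb y1 y2 y3 h).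
by rewrite !frame_combE; ring.
Qed.

Lemma frame_comb_span2 x1 x2 : smooth x1 -> smooth x2 ->
  span2 A e1 e2 (frame_comb x1 x2 0).
Proof.
move=> sx1 sx2; exists x1, x2; split=> //; apply/funext => h.
by rewrite frame_combE mul0r addr0.
Qed.

Lemma span2_frame_comb X : span2 A e1 e2 X ->
  exists x1 x2, [/\ smooth x1, smooth x2 & X = frame_comb x1 x2 0].
Proof.
move=> [x1 [x2 [sx1 sx2 ->]]]; exists x1, x2; split=> //; apply/funext => h.
by rewrite frame_combE mul0r addr0.
Qed.

Lemma frame_comb_span1 x3 : smooth x3 -> span1 A e3 (frame_comb 0 0 x3).
Proof.
move=> sx3; exists x3 => //; apply/funext => h.
by rewrite frame_combE !mul0r !add0r.
Qed.

Lemma span1_frame_comb X : span1 A e3 X ->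
  exists2 x3, smooth x3 & X = frame_comb 0 0 x3.
Proof.
move=> [x3 sx3 ->]; exists x3 => //; apply/funext => h.
by rewrite frame_combE !mul0r !add0r.
Qed.

(** A connection is determined by its values on a frame: C^oo-linearity in the
    first argument and the Leibniz rule in the second one. *)
Lemma connection_frame_comb D x1 x2 x3 y1 y2 y3 : connection A D ->
  smooth x1 -> smooth x2 -> smooth x3 ->
  smooth y1 -> smooth y2 -> smooth y3 ->
  let X := frame_comb x1 x2 x3 in
  let nabla Y := fscale x1 (D e1 Y) + fscale x2 (D e2 Y) + fscale x3 (D e3 Y) in
  D X (frame_comb y1 y2 y3) = frame_comb (X y1) (X y2) (X y3) +
    (fscale y1 (nabla e1) + fscale y2 (nabla e2) + fscale y3 (nabla e3)).
Proof.
move=> [_ Dl Zl Dr leib] sx1 sx2 sx3 sy1 sy2 sy3 X nabla.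
have vX : vector_field A X by exact: frame_comb_vector_field.
have vZ := @vector_field_fscale _ _ _ A.
have vD := @vector_field_add _ _ _ A.
have nablaE Y : vector_field A Y -> D X Y = nabla Y.
  move=> vY; rewrite /X /frame_comb Dl ?Dl ?Zl //; try exact: vZ.
  by apply: vD; exact: vZ.
rewrite [in LHS]/frame_comb Dr ?Dr ?leib ?nablaE//; try exact: vZ.
  apply/funext => h; apply/funext => p.
  rewrite /frame_comb !fctE; ring.
by apply: vD; exact: vZ.
Qed.

(** On non-smooth functions both sides vanish by convention; on smooth ones
    the second derivatives only occur in the brackets of the frame. *)
Lemma lie_bracket_frame_comb x1 x2 x3 z1 z2 z3 (a b c : R) :
  smooth x1 -> smooth x2 -> smooth x3 ->
  smooth z1 -> smooth z2 -> smooth z3 ->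
  lie_bracket e1 e2 = - c *: e3 ->
  lie_bracket e1 e3 = - b *: e2 ->
  lie_bracket e2 e3 = a *: e1 ->
  let X := frame_comb x1 x2 x3 in
  let Z := frame_comb z1 z2 z3 in
  lie_bracket X Z = frame_comb
    (X z1 - Z x1 + cst a * (x2 * z3 - x3 * z2))
    (X z2 - Z x2 - cst b * (x1 * z3 - x3 * z1))
    (X z3 - Z x3 - cst c * (x1 * z2 - x2 * z1)).
Proof.
move=> sx1 sx2 sx3 sz1 sz2 sz3 b12 b13 b23 X Z.
have vX : vector_field A X by exact: frame_comb_vector_field.
have vZ : vector_field A Z by exact: frame_comb_vector_field.
apply/funext => h; rewrite -[LHS]/(X (Z h) - Z (X h)).
have [sh|nh] := pselect (smooth h); last first.
  rewrite (vector_field0 vZ nh) (vector_field0 vX nh) frame_combE.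
  rewrite (vector_field0 ve1 nh) (vector_field0 ve2 nh) (vector_field0 ve3 nh).
  rewrite (vector_field_cst 0 vX) (vector_field_cst 0 vZ).
  by rewrite !mulr0 !addr0 subr0.
have se1 := vector_field_smooth ve1 sh; have se2 := vector_field_smooth ve2 sh.
have se3 := vector_field_smooth ve3 sh.
have der U u1 u2 u3 : vector_field A U -> smooth u1 -> smooth u2 -> smooth u3 ->
    U (frame_comb u1 u2 u3 h) = U u1 * e1 h + U u2 * e2 h + U u3 * e3 h +
      (u1 * U (e1 h) + u2 * U (e2 h) + u3 * U (e3 h)).
  move=> vU su1 su2 su3; rewrite frame_combE.
  rewrite !(vector_fieldD vU) ?(vector_fieldM vU)//;
    try by do ?apply: smooth_funD; exact: smooth_funM.
  ring.
rewrite !der//.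
have {b12}E12 : e1 (e2 h) = e2 (e1 h) - cst c * e3 h.
  apply/eqP; rewrite addrC -subr_eq; apply/eqP.
  transitivity ((- c *: e3) h); first by rewrite -b12.
  by apply/funext => p; exact: mulNr.
have {b13}E13 : e1 (e3 h) = e3 (e1 h) - cst b * e2 h.
  apply/eqP; rewrite addrC -subr_eq; apply/eqP.
  transitivity ((- b *: e2) h); first by rewrite -b13.
  by apply/funext => p; exact: mulNr.
have {b23}E23 : e2 (e3 h) = e3 (e2 h) + cst a * e1 h.
  apply/eqP; rewrite addrC -subr_eq; apply/eqP.
  transitivity ((a *: e1) h); first by rewrite -b23.
  by apply/funext => p.
rewrite /X /Z !frame_combE E12 E13 E23; ring.
Qed.

Variable g : operator R G -> operator R G -> G -> R.
Hypothesis tg : tensor02 A g.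
Hypothesis gC : forall X Y, vector_field A X -> vector_field A Y ->
  g X Y = g Y X.
Hypothesis og : pseudo_orthonormal g e1 e2 e3.

Lemma metric_frame_comb x1 x2 x3 y1 y2 y3 :
  smooth x1 -> smooth x2 -> smooth x3 ->
  smooth y1 -> smooth y2 -> smooth y3 ->
  g (frame_comb x1 x2 x3) (frame_comb y1 y2 y3) = x1 * y1 + x2 * y2 - x3 * y3.
Proof.
move=> sx1 sx2 sx3 sy1 sy2 sy3; have [_ Dl Dr Zl Zr] := tg.
have vZ := @vector_field_fscale _ _ _ A.
have vD := @vector_field_add _ _ _ A.
have gl Y : vector_field A Y -> g (frame_comb x1 x2 x3) Y =
    x1 * g e1 Y + x2 * g e2 Y + x3 * g e3 Y.
  move=> vY; rewrite /frame_comb Dl ?Dl ?Zl //; try exact: vZ.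
  by apply: vD; exact: vZ.
have gr X : vector_field A X -> g X (frame_comb y1 y2 y3) =
    y1 * g X e1 + y2 * g X e2 + y3 * g X e3.
  move=> vX; rewrite /frame_comb Dr ?Dr ?Zr //; try exact: vZ.
  by apply: vD; exact: vZ.
rewrite gl; last exact: frame_comb_vector_field.
rewrite !gr// (gC ve2 ve1) (gC ve3 ve1) (gC ve3 ve2).
apply/funext => p; have [[g11 g22 g33] [g12 g13 g23]] := og p.
rewrite !fctE g11 g22 g33 g12 g13 g23; ring.
Qed.

Lemma metric_frame_comb1 x1 x2 x3 :
  smooth x1 -> smooth x2 -> smooth x3 ->
  g (frame_comb x1 x2 x3) e1 = x1.
Proof.
move=> sx1 sx2 sx3; have [s0 s1] := (smooth_fun0, smooth_fun1).
rewrite [X in g _ X]frame_comb1 metric_frame_comb//.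
by rewrite mulr1 !mulr0 addr0 subr0.
Qed.

Lemma metric_frame_comb2 x1 x2 x3 :
  smooth x1 -> smooth x2 -> smooth x3 ->
  g (frame_comb x1 x2 x3) e2 = x2.
Proof.
move=> sx1 sx2 sx3; have [s0 s1] := (smooth_fun0, smooth_fun1).
rewrite [X in g _ X]frame_comb2 metric_frame_comb//.
by rewrite mulr1 !mulr0 add0r subr0.
Qed.

Lemma metric_frame_comb3 x1 x2 x3 :
  smooth x1 -> smooth x2 -> smooth x3 ->
  g (frame_comb x1 x2 x3) e3 = - x3.
Proof.
move=> sx1 sx2 sx3; have [s0 s1] := (smooth_fun0, smooth_fun1).
rewrite [X in g _ X]frame_comb3 metric_frame_comb//.
by rewrite mulr1 !mulr0 !add0r.
Qed.

Lemma frame_comb_inj x1 x2 x3 y1 y2 y3 :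
  smooth x1 -> smooth x2 -> smooth x3 ->
  smooth y1 -> smooth y2 -> smooth y3 ->
  frame_comb x1 x2 x3 = frame_comb y1 y2 y3 -> [/\ x1 = y1, x2 = y2 & x3 = y3].
Proof.
move=> sx1 sx2 sx3 sy1 sy2 sy3 xy.
split.
- by rewrite -(metric_frame_comb1 sx1 sx2 sx3) xy metric_frame_comb1.
- by rewrite -(metric_frame_comb2 sx1 sx2 sx3) xy metric_frame_comb2.
- apply: oppr_inj.
  by rewrite -(metric_frame_comb3 sx1 sx2 sx3) xy metric_frame_comb3.
Qed.

(** Uniqueness of the decomposition, on which [proj] depends, comes from the
    uniqueness of the coordinates. *)
Lemma proj_span2 x1 x2 x3 : smooth x1 -> smooth x2 -> smooth x3 ->
  Defs.proj (span2 A e1 e2) (span1 A e3) (frame_comb x1 x2 x3) =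
  frame_comb x1 x2 0.
Proof.
move=> sx1 sx2 sx3; have s0 := smooth_fun0; apply: xget_unique.
  split; first exact: frame_comb_span2.
  by rewrite frame_combB !subrr subr0; exact: frame_comb_span1.
move=> _ [/span2_frame_comb[y1 [y2 [sy1 sy2 ->]]]].
rewrite frame_combB => /span1_frame_comb[y3 sy3].
case/frame_comb_inj => //; try exact: smooth_funB.
by move=> /subr0_eq -> /subr0_eq ->.
Qed.

Lemma proj_span1 x1 x2 x3 : smooth x1 -> smooth x2 -> smooth x3 ->
  Defs.proj (span1 A e3) (span2 A e1 e2) (frame_comb x1 x2 x3) =
  frame_comb 0 0 x3.
Proof.
move=> sx1 sx2 sx3; have s0 := smooth_fun0; apply: xget_unique.
  split; first exact: frame_comb_span1.
  by rewrite frame_combB !subrr !subr0; exact: frame_comb_span2.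
move=> _ [/span1_frame_comb[y3 sy3 ->]].
rewrite frame_combB => /span2_frame_comb[y1 [y2 [sy1 sy2]]].
case/frame_comb_inj => //; try exact: smooth_funB.
by move=> _ _ /subr0_eq ->.
Qed.

End Frame.

(** * The Bott connection of the group and its curvature *)

Section BottG3.
Context {R : realType} {G : topGroupType}.
Variable A : smooth_structure (R := R) 3 G.
Variables alpha beta gamma : R.
Variables e1 e2 e3 : operator R G.
Variable g : operator R G -> operator R G -> G -> R.
Variables nablaL nablaB : operator R G -> operator R G -> operator R G.
Implicit Types (X Y Z : operator R G) (f h x y z : G -> R).

Hypothesis lorg : lorentzian_metric A g.
Hypothesis basis : lie_algebra_basis A e1 e2 e3.
Hypothesis og : pseudo_orthonormal g e1 e2 e3.
Hypothesis b12 : lie_bracket e1 e2 = - gamma *: e3.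
Hypothesis b13 : lie_bracket e1 e3 = - beta *: e2.
Hypothesis b23 : lie_bracket e2 e3 = alpha *: e1.
Hypothesis lcL : levi_civita A g nablaL.
Hypothesis bottB :
  bott_connection A (span2 A e1 e2) (span1 A e3) nablaL nablaB.

Local Notation smooth := (smooth_fun A).
Local Notation comb := (frame_comb e1 e2 e3).

Let tg : tensor02 A g. Proof. by case: lorg. Qed.
Let gC X Y : vector_field A X -> vector_field A Y -> g X Y = g Y X.
Proof. by case: lorg => _ + _; exact. Qed.
Let ve1 : vector_field A e1. Proof. by case: basis => -[[]]. Qed.
Let ve2 : vector_field A e2. Proof. by case: basis => -[_ []]. Qed.
Let ve3 : vector_field A e3. Proof. by case: basis => -[_ _ []]. Qed.
Let s0 : smooth 0. Proof. exact: smooth_fun0. Qed.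
Let s1 : smooth 1. Proof. exact: smooth_fun1. Qed.
Let sc (a : R) : smooth (cst a). Proof. exact: smooth_fun_cst. Qed.

Lemma basis_frame X : vector_field A X ->
  exists x1 x2 x3, [/\ smooth x1, smooth x2, smooth x3 & X = comb x1 x2 x3].
Proof.
move=> vX; have [[inv1 inv2 inv3] free123 _] := basis.
pose E (i : 'I_3) := nth e1 [:: e1; e2; e3] i.
have invE i : left_invariant A (E i) by case: i => [[|[|[|]]]].
have [||u [su ->]] := @pointwise_free_frame _ _ _ A E X _ _ vX.
- by move=> i; have [] := invE i.
- apply: left_invariant_pointwise_free => // c.
  rewrite !big_ord_recl big_ord0 addr0 addrA => /free123[c1 c2 c3] i.
  case: i => [[|[|[|//]]] i3];
    [rewrite -[RHS]c1|rewrite -[RHS]c2|rewrite -[RHS]c3];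
    by congr (c _); exact/val_inj.
- exists (u ord0), (u (lift ord0 ord0)), (u (lift ord0 (lift ord0 ord0))).
  split; try exact: su.
  by rewrite !big_ord_recl big_ord0 addr0 addrA.
Qed.

Lemma levi_civita_constant X Y Z (a : R) :
  vector_field A X -> vector_field A Y -> vector_field A Z ->
  g Y Z = cst a -> g (nablaL X Y) Z + g Y (nablaL X Z) = 0.
Proof.
move=> vX vY vZ gYZ; have [_ _ metr] := lcL.
by rewrite -metr// gYZ; exact: vector_field_cst vX.
Qed.

(** Write L_ijk for g(DL_ei ej, ek). It is skew in j and k since g(ej, ek) is
    constant, and for i, j, k in the plane it is symmetric in i and j, since
    [e1, e2] is proportional to e3. With two indices available this forces
    L = 0 on the plane. Skewness also gives L_333 = 0. *)
Lemma levi_civita_plane :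
  [/\ [/\ g (nablaL e1 e1) e1 = 0, g (nablaL e1 e1) e2 = 0 &
          g (nablaL e1 e2) e1 = 0],
      [/\ g (nablaL e1 e2) e2 = 0, g (nablaL e2 e1) e1 = 0 &
          g (nablaL e2 e1) e2 = 0] &
      [/\ g (nablaL e2 e2) e1 = 0, g (nablaL e2 e2) e2 = 0 &
          g (nablaL e3 e3) e3 = 0]].
Proof.
have [[vL _ _ _ _] tors _] := lcL.
have g11 : g e1 e1 = cst 1 by apply/funext => p; have [[]] := og p.
have g22 : g e2 e2 = cst 1 by apply/funext => p; have [[]] := og p.
have g33 : g e3 e3 = cst (-1) by apply/funext => p; have [[]] := og p.
have g12 : g e1 e2 = cst 0 by apply/funext => p; have [_ []] := og p.
have g13 : g e1 e3 = cst 0 by apply/funext => p; have [_ []] := og p.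
have g23 : g e2 e3 = cst 0 by apply/funext => p; have [_ []] := og p.
have half (F : G -> R) : F + F = 0 -> F = 0.
  move=> FF; apply/funext => p; have /eqP : F p *+ 2 = 0.
    by rewrite mulr2n -[LHS]/((F + F) p) FF.
  by rewrite mulrn_eq0 => /eqP.
have norm0 X Y (a : R) : vector_field A X -> vector_field A Y ->
    g Y Y = cst a -> g (nablaL X Y) Y = 0.
  move=> vX vY /(levi_civita_constant vX vY vY).
  rewrite (gC vY); last exact: vL.
  exact: half.
have skew X : vector_field A X -> g (nablaL X e1) e2 = - g (nablaL X e2) e1.
  move=> vX; apply/eqP; rewrite -addr_eq0 (gC (vL _ _ vX ve2) ve1).
  by rewrite (levi_civita_constant vX ve1 ve2 g12).
have sym Y : vector_field A Y -> g e3 Y = 0 ->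
    g (nablaL e1 e2) Y = g (nablaL e2 e1) Y.
  move=> vY g3Y; have /eqP := tors _ _ ve1 ve2.
  rewrite b12 subr_eq => /eqP ->.
  rewrite -[- gamma *: e3]/(fscale (cst (- gamma)) e3) (tensor02Dl tg)//.
  - rewrite (tensor02Zl tg)//= g3Y; apply/funext => p.
    by rewrite /= -[LHS]/(- gamma * 0 + _) mulr0 add0r.
  - exact: vector_field_fscale.
  - exact: vL.
have L121 : g (nablaL e1 e2) e1 = 0.
  by rewrite sym// ?(norm0 _ _ _ ve2 ve1 g11)// gC.
have L212 : g (nablaL e2 e1) e2 = 0.
  by rewrite -sym// ?(norm0 _ _ _ ve1 ve2 g22)// gC.
split; split.
- exact: norm0 g11.
- by rewrite skew// L121 oppr0.
- exact: L121.
- exact: norm0 g22.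
- exact: norm0 g11.
- exact: L212.
- by apply: oppr_inj; rewrite -skew// L212 oppr0.
- exact: norm0 g22.
- exact: norm0 g33.
Qed.

Local Notation D12 := (span2 A e1 e2).
Local Notation D3 := (span1 A e3).

Lemma proj_plane_eq0 X : vector_field A X ->
  g X e1 = 0 -> g X e2 = 0 -> Defs.proj D12 D3 X = 0.
Proof.
move=> /basis_frame[x1 [x2 [x3 [sx1 sx2 sx3 ->]]]].
rewrite (metric_frame_comb1 ve1 ve2 ve3 tg gC og)// => ->.
rewrite (metric_frame_comb2 ve1 ve2 ve3 tg gC og)// => ->.
rewrite (proj_span2 ve1 ve2 ve3 tg gC og)//.
by apply/funext => h; rewrite frame_combE !mul0r !addr0.
Qed.

Lemma proj_line_eq0 X : vector_field A X ->
  g X e3 = 0 -> Defs.proj D3 D12 X = 0.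
Proof.
move=> /basis_frame[x1 [x2 [x3 [sx1 sx2 sx3 ->]]]].
rewrite (metric_frame_comb3 ve1 ve2 ve3 tg gC og)// => /eqP.
rewrite oppr_eq0 => /eqP ->.
rewrite (proj_span1 ve1 ve2 ve3 tg gC og)//.
by apply/funext => h; rewrite frame_combE !mul0r !addr0.
Qed.

Lemma bott_frame :
  [/\ [/\ nablaB e1 e1 = 0, nablaB e1 e2 = 0 & nablaB e1 e3 = 0],
      [/\ nablaB e2 e1 = 0, nablaB e2 e2 = 0 & nablaB e2 e3 = 0] &
      [/\ nablaB e3 e1 = fscale (cst beta) e2,
          nablaB e3 e2 = fscale (cst (- alpha)) e1 & nablaB e3 e3 = 0]].
Proof.
have [_ BDD BQD BDQ BQQ] := bottB.
have [[vL _ _ _ _] _ _] := lcL.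
have [[L111 L112 L121] [L122 L211 L212] [L221 L222 L333]] := levi_civita_plane.
have P1 : D12 e1.
  by rewrite [X in D12 X](frame_comb1 e1 e2 e3); exact: frame_comb_span2.
have P2 : D12 e2.
  by rewrite [X in D12 X](frame_comb2 e1 e2 e3); exact: frame_comb_span2.
have Q3 : D3 e3.
  by rewrite [X in D3 X](frame_comb3 e1 e2 e3); exact: frame_comb_span1.
have in_plane x1 x2 : smooth x1 -> smooth x2 ->
    Defs.proj D3 D12 (comb x1 x2 0) = 0.
  move=> sx1 sx2; rewrite (proj_span1 ve1 ve2 ve3 tg gC og)//.
  by apply/funext => h; rewrite frame_combE !mul0r !addr0.
have b13' : lie_bracket e1 e3 = comb 0 (cst (- beta)) 0.
  by rewrite b13; apply/funext => h; rewrite frame_combE !mul0r addr0 add0r.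
have b23' : lie_bracket e2 e3 = comb (cst alpha) 0 0.
  by rewrite b23; apply/funext => h; rewrite frame_combE !mul0r !addr0.
have b31 : lie_bracket e3 e1 = comb 0 (cst beta) 0.
  apply/funext => h; rewrite frame_combE !mul0r addr0 add0r.
  rewrite -[LHS]opprB -[X in - X]/(lie_bracket e1 e3 h) b13.
  by apply/funext => p; rewrite -[LHS]/(- (- beta * e2 h p)) mulNr opprK.
have b32 : lie_bracket e3 e2 = comb (cst (- alpha)) 0 0.
  apply/funext => h; rewrite frame_combE !mul0r !addr0.
  rewrite -[LHS]opprB -[X in - X]/(lie_bracket e2 e3 h) b23.
  by apply/funext => p; rewrite -[LHS]/(- (alpha * e1 h p)) -mulNr.
split; split.
- by rewrite BDD// proj_plane_eq0//; exact: vL.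
- by rewrite BDD// proj_plane_eq0//; exact: vL.
- by rewrite BDQ// b13' in_plane.
- by rewrite BDD// proj_plane_eq0//; exact: vL.
- by rewrite BDD// proj_plane_eq0//; exact: vL.
- by rewrite BDQ// b23' in_plane.
- rewrite BQD// b31 (proj_span2 ve1 ve2 ve3 tg gC og)//.
  by apply/funext => h; rewrite frame_combE !mul0r addr0 add0r.
- rewrite BQD// b32 (proj_span2 ve1 ve2 ve3 tg gC og)//.
  by apply/funext => h; rewrite frame_combE !mul0r !addr0.
- by rewrite BQQ// proj_line_eq0//; exact: vL.
Qed.

Lemma bott_frame_comb x1 x2 x3 y1 y2 y3 :
  smooth x1 -> smooth x2 -> smooth x3 ->
  smooth y1 -> smooth y2 -> smooth y3 ->
  let X := comb x1 x2 x3 in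
  nablaB X (comb y1 y2 y3) =
    comb (X y1 - cst alpha * (x3 * y2)) (X y2 + cst beta * (x3 * y1)) (X y3).
Proof.
move=> sx1 sx2 sx3 sy1 sy2 sy3 X; have [cB _ _ _ _] := bottB.
rewrite /X (connection_frame_comb ve1 ve2 ve3 cB)// -/X.
have [[-> -> ->] [-> -> ->] [-> -> ->]] := bott_frame.
have f0 x : fscale x (0 : operator R G) = 0.
  by apply/funext => h; apply/funext => p; exact: mulr0.
rewrite !(f0, addr0, add0r); apply/funext => h; apply/funext => p.
rewrite /frame_comb !fctE /fscale; ring.
Qed.

(** All derivatives of the coordinates cancel, in agreement with the tensorial
    character of the curvature. What is left comes from D_[X, Z]: the only
    bracket with an e3-component is [e1, e2] = - gamma e3, and D_e3 sends
    (y1, y2) to (- alpha y2, beta y1). *)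
Lemma curvature_bott x1 x2 x3 y1 y2 y3 z1 z2 z3 :
  smooth x1 -> smooth x2 -> smooth x3 ->
  smooth y1 -> smooth y2 -> smooth y3 ->
  smooth z1 -> smooth z2 -> smooth z3 ->
  curvature nablaB (comb x1 x2 x3) (comb z1 z2 z3) (comb y1 y2 y3) =
  comb (cst (- (alpha * gamma)) * (x1 * z2 - x2 * z1) * y2)
       (cst (beta * gamma) * (x1 * z2 - x2 * z1) * y1) 0.
Proof.
move=> sx1 sx2 sx3 sy1 sy2 sy3 sz1 sz2 sz3; rewrite /curvature.
set X := comb x1 x2 x3; set Z := comb z1 z2 z3.
have vX : vector_field A X by exact: frame_comb_vector_field.
have vZ : vector_field A Z by exact: frame_comb_vector_field.
have sX f : smooth f -> smooth (X f) by exact: vector_field_smooth.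
have sZ f : smooth f -> smooth (Z f) by exact: vector_field_smooth.
have sM := @smooth_funM _ _ _ A; have sD := @smooth_funD _ _ _ A.
have sB := @smooth_funB _ _ _ A.
have brE : lie_bracket X Z = comb
    (X z1 - Z x1 + cst alpha * (x2 * z3 - x3 * z2))
    (X z2 - Z x2 - cst beta * (x1 * z3 - x3 * z1))
    (X z3 - Z x3 - cst gamma * (x1 * z2 - x2 * z1)).
  exact: (lie_bracket_frame_comb (A := A)).
have nX := bott_frame_comb sx1 sx2 sx3; rewrite -/X in nX.
have nZ := bott_frame_comb sz1 sz2 sz3; rewrite -/Z in nZ.
have nbr : nablaB (lie_bracket X Z) (comb y1 y2 y3) = comb
    (X (Z y1) - Z (X y1) -
       cst alpha * ((X z3 - Z x3 - cst gamma * (x1 * z2 - x2 * z1)) * y2))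
    (X (Z y2) - Z (X y2) +
       cst beta * ((X z3 - Z x3 - cst gamma * (x1 * z2 - x2 * z1)) * y1))
    (X (Z y3) - Z (X y3)).
  rewrite -[X (Z y1) - _]/(lie_bracket X Z y1).
  rewrite -[X (Z y2) - _]/(lie_bracket X Z y2).
  rewrite -[X (Z y3) - _]/(lie_bracket X Z y3).
  by rewrite brE bott_frame_comb//; auto 8.
(* Opaque fields prevent the derivation rules from unfolding X f into its
   frame expansion. *)
clearbody X Z.
rewrite nbr !nZ ?nX ?nZ; try by auto 8.
rewrite !(vector_fieldB vX) ?(vector_fieldD vX) ?(vector_fieldB vZ)
  ?(vector_fieldD vZ); try by auto 8.
rewrite !(vector_fieldM vX) ?(vector_fieldM vZ); try by auto 8.
rewrite !(vector_field_cst _ vX) !(vector_field_cst _ vZ) !frame_combB.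
have -> : cst (- (alpha * gamma)) = - (cst alpha * cst gamma) :> (G -> R) by [].
have -> : cst (beta * gamma) = cst beta * cst gamma :> (G -> R) by [].
by congr (frame_comb _ _ _ _ _ _); ring.
Qed.

Lemma ricci_bott x1 x2 x3 y1 y2 y3 :
  smooth x1 -> smooth x2 -> smooth x3 ->
  smooth y1 -> smooth y2 -> smooth y3 ->
  ricci g e1 e2 e3 nablaB (comb x1 x2 x3) (comb y1 y2 y3) =
  cst (- (beta * gamma)) * (x1 * y1) + cst (- (alpha * gamma)) * (x2 * y2).
Proof.
move=> sx1 sx2 sx3 sy1 sy2 sy3.
have C z1 z2 z3 := curvature_bott sx1 sx2 sx3 sy1 sy2 sy3 (z1 := z1)
  (z2 := z2) (z3 := z3).
have C1 := C 1 0 0 s1 s0 s0; rewrite -frame_comb1 in C1.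
have C2 := C 0 1 0 s0 s1 s0; rewrite -frame_comb2 in C2.
have C3 := C 0 0 1 s0 s0 s1; rewrite -frame_comb3 in C3.
pose Ric e := g (curvature nablaB (comb x1 x2 x3) e (comb y1 y2 y3)) e.
rewrite -[LHS]/(- Ric e1 - Ric e2 + Ric e3) /Ric C1 C2 C3.
have sM := @smooth_funM _ _ _ A; have sB := @smooth_funB _ _ _ A.
rewrite (metric_frame_comb1 ve1 ve2 ve3 tg gC og); try by auto 8.
rewrite (metric_frame_comb2 ve1 ve2 ve3 tg gC og); try by auto 8.
rewrite (metric_frame_comb3 ve1 ve2 ve3 tg gC og); try by auto 8.
have cN (a : R) : cst (- a) = - cst a :> (G -> R) by [].
rewrite !cN; ring.
Qed.

Local Notation ric := (sym_ricci g e1 e2 e3 nablaB).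

(** Expressed through g(X, ei) instead of the coordinates, the formula makes
    the tensoriality of the Ricci form inherited from that of [g]. *)
Lemma sym_ricci_bott X Y : vector_field A X -> vector_field A Y ->
  ric X Y = cst (- (beta * gamma)) * (g X e1 * g Y e1) +
            cst (- (alpha * gamma)) * (g X e2 * g Y e2).
Proof.
move=> /basis_frame[x1 [x2 [x3 [sx1 sx2 sx3 ->]]]].
move=> /basis_frame[y1 [y2 [y3 [sy1 sy2 sy3 ->]]]].
rewrite !(metric_frame_comb1 ve1 ve2 ve3 tg gC og)//.
rewrite !(metric_frame_comb2 ve1 ve2 ve3 tg gC og)//.
apply/funext => p; rewrite /sym_ricci !ricci_bott// !fctE.
by field.
Qed.

Lemma tensor02_sym_ricci_bott : tensor02 A ric.
Proof.
have vD := @vector_field_add _ _ _ A; have vZ := @vector_field_fscale _ _ _ A.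
have [sg gDl _ gZl _] := tg.
have gZ f X e : smooth f -> vector_field A X -> vector_field A e ->
    g (fscale f X) e = f * g X e by exact: gZl.
split=> [X Y vX vY|X X' Y vX vX' vY|X Y Y' vX vY vY'|
         f X Y sf vX vY|f X Y sf vX vY].
- rewrite sym_ricci_bott//; apply: smooth_funD;
    by apply: smooth_funM => //; apply: smooth_funM; exact: sg.
- by rewrite !sym_ricci_bott ?gDl//; [ring | exact: vD].
- by rewrite !sym_ricci_bott ?gDl//; [ring | exact: vD].
- rewrite -[RHS]/(f * ric X Y) !sym_ricci_bott ?gZ//; last exact: vZ.
  ring.
- rewrite -[RHS]/(f * ric X Y) !sym_ricci_bott ?gZ//; last exact: vZ.
  ring.
Qed.

(** The derivatives of the coordinates cancel by the Leibniz rule. The two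
    remaining contributions, alpha beta gamma x3 (y1 z2 + y2 z1) from the e1
    and from the e2 part of the Ricci form, have opposite signs. *)
Lemma sym_ricci_bott_parallel X Y Z :
  vector_field A X -> vector_field A Y -> vector_field A Z ->
  cov_deriv nablaB ric X Y Z = 0.
Proof.
move=> vX vY vZ; have [[vB _ _ _ _] _ _ _ _] := bottB.
rewrite -[LHS]/(X (ric Y Z) - ric (nablaB X Y) Z - ric Y (nablaB X Z)).
rewrite !sym_ricci_bott//; try exact: vB.
have [x1 [x2 [x3 [sx1 sx2 sx3 eX]]]] := basis_frame vX.
have [y1 [y2 [y3 [sy1 sy2 sy3 ->]]]] := basis_frame vY.
have [z1 [z2 [z3 [sz1 sz2 sz3 ->]]]] := basis_frame vZ.
have nX := bott_frame_comb sx1 sx2 sx3; rewrite /= -eX in nX; rewrite !nX//.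
have sX f : smooth f -> smooth (X f) by exact: vector_field_smooth.
have sM := @smooth_funM _ _ _ A; have sD := @smooth_funD _ _ _ A.
have sB := @smooth_funB _ _ _ A.
rewrite !(metric_frame_comb1 ve1 ve2 ve3 tg gC og); try by auto 8.
rewrite !(metric_frame_comb2 ve1 ve2 ve3 tg gC og); try by auto 8.
rewrite !(vector_fieldD vX) ?(vector_fieldM vX) ?(vector_field_cst _ vX);
  try by auto 8.
have cN (a : R) : cst (- a) = - cst a :> (G -> R) by [].
have cM (a b : R) : cst (a * b) = cst a * cst b :> (G -> R) by [].
rewrite !cN !cM; ring.
Qed.

End BottG3.

Theorem theorem2p10 (R : realType) (alpha beta gamma : R)
    (G : topGroupType) (A : smooth_structure (R := R) 3 G)
    (g : operator R G -> operator R G -> G -> R)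
    (e1 e2 e3 : operator R G)
    (nablaL nablaB : operator R G -> operator R G -> operator R G) :
  lie_group A ->
  connected [set: G] ->
  simply_connected R G ->
  lorentzian_metric A g ->
  left_invariant_metric A g ->
  lie_algebra_basis A e1 e2 e3 ->
  pseudo_orthonormal g e1 e2 e3 ->
  lie_bracket e1 e2 = - gamma *: e3 ->
  lie_bracket e1 e3 = - beta *: e2 ->
  lie_bracket e2 e3 = alpha *: e1 ->
  levi_civita A g nablaL ->
  bott_connection A (span2 A e1 e2) (span1 A e3) nablaL nablaB ->
  codazzi_tensor A nablaB (sym_ricci g e1 e2 e3 nablaB).
Proof.
move=> _ _ _ lorg _ basis og b12 b13 b23 lcL bottB.
have parallel := sym_ricci_bott_parallel lorg basis og b12 b13 b23 lcL bottB.
split.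
  exact: tensor02_sym_ricci_bott lorg basis og b12 b13 b23 lcL bottB.
move=> X Y Z vX vY vZ p.
by rewrite !parallel// subr0.
Qed.
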